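(* Let $\alpha$ be a complex parameter in the modular strip, and let $W$ be one of the groups $[G(2,1,n)]_1^\alpha$ ($n\ge1$) or $[W(A_{n-1})]^\alpha$ ($n\ge2$), with linear part $\mathrm{Lin}(W)$ equal to $G(2,1,n)$, respectively $W(A_{n-1})=\mathfrak S_n$. For a reflection group $G$ let $m(G)$ denote the minimal number of reflections needed to generate $G$. Then $$m(W)=m(\mathrm{Lin}(W))+2.$$
   Context: The modular strip is the standard fundamental domain of $SL_2(\mathbb Z)$ acting on the upper half-plane, so in particular $\operatorname{Im}\alpha>0$. Put $\Lambda_\alpha=\mathbb Z+\alpha\mathbb Z\subset\mathbb C$. $[G(2,1,n)]_1^\alpha$ is the group of affine transformations $z\mapsto gz+t$ of $\mathbb C^n$ with $g\in G(2,1,n)$ (signed $n\times n$ permutation matrices) and $t\in\Lambda_\alpha^n$. $[W(A_{n-1})]^\alpha$ is the group of affine transformations $z\mapsto gz+t$ of $V=\{z\in\mathbb C^n: z_1+\dots+z_n=0\}$ with $g\in\mathfrak S_n$ (permuting coordinates) and $t\in\Lambda_\alpha^n\cap V$. $\mathrm{Lin}(W)$ is the finite group of linear parts $g$, acting linearly on $\mathbb C^n$ (respectively $V$). A reflection is a non-identity affine (or linear) transformation of finite order fixing pointwise a complex affine hyperplane. *)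

(* Defs.v *)
From mathcomp Require Import all_boot all_order all_algebra all_fingroup.
From mathcomp Require Import boolp classical_sets reals.
From mathcomp Require Import complex.

Set Implicit Arguments.
Unset Strict Implicit.
Unset Printing Implicit Defensive.

Import Order.TTheory GRing.Theory Num.Theory.
Local Open Scope ring_scope.
Local Open Scope classical_set_scope.
Local Open Scope complex_scope.

Section TransformationGroups.
Variable T : Type.

Definition is_transformation_group (G : set (T -> T)) : Prop :=
  [/\ G id,
      forall f g, G f -> G g -> G (f \o g) &
      forall f, G f -> exists f', [/\ G f', cancel f f' & cancel f' f]].

Definition generated_group (S : set (T -> T)) : set (T -> T) :=
  smallest is_transformation_group S.

End TransformationGroups.

Section Reflections.
Variables (K : fieldType) (vT : vectType K).

Definition affine_map (f : vT -> vT) : Prop :=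
  exists (g : 'End(vT)) (t : vT), forall z, f z = g z + t.

Definition finite_order (f : vT -> vT) : Prop :=
  exists2 k : nat, (0 < k)%N & forall z, iter k f z = z.

Definition fixes_affine_hyperplane (f : vT -> vT) : Prop :=
  exists (p : vT) (H : {vspace vT}),
    (\dim H).+1 = \dim {:vT} /\ forall h, h \in H -> f (p + h) = p + h.

Definition reflection (f : vT -> vT) : Prop :=
  [/\ affine_map f, f <> id, finite_order f & fixes_affine_hyperplane f].

(* Repetitions in the family are allowed; they do not affect the least [k]. *)
Definition generated_by_reflections (G : set (vT -> vT)) (k : nat) : Prop :=
  exists s : 'I_k -> vT -> vT,
    (forall i, reflection (s i)) /\ generated_group (range s) = G.

(* [min_reflections G k] reads m(G) = k; in particular it asserts that [G] is
   generated by finitely many reflections. *)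
Definition min_reflections (G : set (vT -> vT)) (k : nat) : Prop :=
  generated_by_reflections G k /\
  forall j, generated_by_reflections G j -> (k <= j)%N.

Definition Lin (W : set (vT -> vT)) : set (vT -> vT) :=
  [set (fun z => f z - f 0) | f in W].

End Reflections.

Section CrystallographicGroups.
Variable R : realType.

(* Closed form of the fundamental domain: it contains the strict one for every
   convention on which half of the boundary to keep. *)
Definition modular_strip (alpha : R[i]) : Prop :=
  [/\ 0 < complex.Im alpha, `|complex.Re alpha| <= 2^-1 & 1 <= `|alpha|].

Definition period_lattice (alpha : R[i]) : set R[i] :=
  [set z | exists a b : int, z = a%:~R + b%:~R * alpha].

Variable n : nat.
Implicit Type alpha : R[i].

Definition G21 : set 'M[R[i]]_n :=
  [set g | exists (e : 'I_n -> bool) (s : 'S_n),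
     g = diag_mx (\row_i (-1) ^+ e i) *m perm_mx s].

Definition G21_linear : set ('cV[R[i]]_n -> 'cV[R[i]]_n) :=
  [set f | exists2 g, G21 g & forall z, f z = g *m z].

Definition G21_crystal alpha : set ('cV[R[i]]_n -> 'cV[R[i]]_n) :=
  [set f | exists (g : 'M[R[i]]_n) (t : 'cV[R[i]]_n),
     [/\ G21 g, forall i, period_lattice alpha (t i 0) &
         forall z, f z = g *m z + t]].

Definition zero_sum : {vspace 'cV[R[i]]_n} :=
  lker (linfun (mulmx (const_mx 1 : 'rV[R[i]]_n))).

Lemma mem_zero_sum (z : 'cV[R[i]]_n) :
  (z \in zero_sum) = (\sum_i z i 0 == 0).
Proof.
rewrite memv_ker lfunE /=.
have -> : const_mx 1 *m z = (\sum_i z i 0)%:M :> 'M_1.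
  by apply/matrixP=> i j; rewrite !ord1 !mxE eqxx mulr1n;
     apply: eq_bigr => k _; rewrite mxE mul1r.
apply/eqP/eqP=> [/matrixP/(_ 0 0)|->]; last by rewrite raddf0.
by rewrite !mxE eqxx mulr1n.
Qed.

Definition A_linear : set (subvs_of zero_sum -> subvs_of zero_sum) :=
  [set f | exists s : 'S_n, forall z, vsval (f z) = perm_mx s *m vsval z].

Definition A_crystal alpha : set (subvs_of zero_sum -> subvs_of zero_sum) :=
  [set f | exists (s : 'S_n) (t : subvs_of zero_sum),
     (forall i, period_lattice alpha (vsval t i 0)) /\
     forall z, vsval (f z) = perm_mx s *m vsval z + vsval t].

Lemma period_lattice0 alpha : period_lattice alpha 0.
Proof. by exists 0, 0; rewrite mul0r addr0. Qed.

Lemma Lin_G21_crystal alpha : Lin (G21_crystal alpha) = G21_linear.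
Proof.
apply/seteqP; split=> f /=.
  move=> [h [g [t [Gg _ hE]]] <-]; exists g => // z.
  by rewrite !hE mulmx0 add0r addrK.
move=> [g Gg fE]; exists f; last by apply/funext=> z; rewrite !fE mulmx0 subr0.
exists g, 0; split=> // [i|z]; last by rewrite fE addr0.
by rewrite mxE; exact: period_lattice0.
Qed.

Lemma Lin_A_crystal alpha : Lin (A_crystal alpha) = A_linear.
Proof.
have v0 : vsval (0 : subvs_of zero_sum) = 0 by exact: linear0.
have vB (x y : subvs_of zero_sum) : vsval (x - y) = vsval x - vsval y.
  exact: linearB.
apply/seteqP; split=> f /=.
  move=> [h [s [t [_ hE]]] <-]; exists s => z.
  by rewrite vB !hE v0 mulmx0 add0r addrK.
move=> [s fE]; exists f; last first.
  apply/funext=> z; apply: val_inj; have := vB (f z) (f 0).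
  by rewrite [vsval (f 0)]fE v0 mulmx0 subr0.
exists s, 0; split=> [i|z]; last by rewrite fE v0 addr0.
by rewrite v0 mxE; exact: period_lattice0.
Qed.

End CrystallographicGroups.

(* Main.v *)
Require Import Defs.
From HB Require Import structures.
From mathcomp Require Import all_boot all_order all_algebra all_fingroup.
From mathcomp Require Import boolp classical_sets reals complex.
From mathcomp Require Import ring.

(** The linear part of either group has no nonzero fixed vector in its space [V],
    of dimension [d] say, and the count to be proved is [d] for the linear group
    and [d + 2] for the crystallographic one.

    Lower bound ([reflection_count_ge]).  The maps [z |-> g z + t] of [W] act
    linearly on [V * C^2].  The translation part [t] splits as [t = a + alpha b]
    with [a] and [b] real; the linear parts are real matrices, so they respect
    this splitting, and [(z, u, v) |-> (g z + u a + v b, u, v)] is an action.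
    For a reflection fixing [p + H], write [p = p1 + alpha p2] with [p1] and [p2]
    real; the vector [(z, u, v)] is fixed as soon as [z - u p1 - v p2] lies in
    [H], which is one linear condition.  Fewer than [d + 2] reflections therefore
    have a common nonzero fixed vector [(z, u, v)], which is then fixed by the
    group they generate.  If this group is [W], the translations by [w] and
    [alpha w], for a real [w != 0], force [u = v = 0]; then [z] is fixed by every
    linear part, hence [z = 0], a contradiction.  The same argument without the
    coordinates [u] and [v] bounds the linear group by [d], so the proof is
    carried out for an arbitrary number of extra coordinates.

    Upper bound ([min_reflections_G21], [min_reflections_A]).  The transpositions
    [(0 i)] generate the symmetric group, and one sign change completes them to a
    generating set of [G(2,1,n)]: these are [d] reflections.  Adding, for each of
    [1] and [alpha], one reflection with the same linear part as a linear
    generator, one obtains the translations by [r] and [alpha r] for one vector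
    [r]; conjugation by the linear group and addition give all others. *)

Set Implicit Arguments.
Unset Strict Implicit.
Unset Printing Implicit Defensive.

Import Order.TTheory GRing.Theory Num.Theory.
Local Open Scope ring_scope.
Local Open Scope classical_set_scope.
Local Open Scope complex_scope.

(** * Linear parts of affine maps *)

Section AffineGroups.
Variables (K : fieldType) (vT : vectType K).
Implicit Types (f : vT -> vT) (W : set (vT -> vT)).

Definition linear_part f : vT -> vT := fun z => f z - f 0.

Lemma linear_partD f : affine_map f ->
  {morph linear_part f : x y / x + y}.
Proof.
move=> [g [t fE]] x y; rewrite /linear_part !fE !linear0 !add0r !addrK.
exact: linearD.
Qed.

Lemma linear_partZ f a : affine_map f ->
  {morph linear_part f : x / a *: x}.
Proof.
move=> [g [t fE]] x; rewrite /linear_part !fE !linear0 !add0r !addrK.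
exact: linearZ.
Qed.

Lemma linear_part0 f : linear_part f 0 = 0.
Proof. exact: subrr. Qed.

Lemma linear_partB f x y : affine_map f ->
  linear_part f (x - y) = f x - f y.
Proof.
move=> [g [t fE]]; rewrite /linear_part !fE linear0 add0r addrK linearB.
by rewrite opprD addrACA subrr addr0.
Qed.

Lemma linear_part_comp f h : affine_map f ->
  linear_part (f \o h) = linear_part f \o linear_part h.
Proof. by move=> af; apply/funext => z; rewrite /= linear_partB. Qed.

Lemma Lin_is_group W : (forall f, W f -> affine_map f) -> is_transformation_group W ->
  is_transformation_group (Lin W).
Proof.
move=> aW [W1 WM WV]; split.
- by exists id => //; apply/funext=> z; rewrite subr0.
- move=> _ _ [f Wf <-] [h Wh <-]; exists (f \o h); first exact: WM.
  by have := linear_part_comp h (aW _ Wf).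
- move=> _ [f Wf <-]; have [f' [Wf' fK f'K]] := WV f Wf.
  exists (linear_part f'); split; first by exists f'.
    move=> z; rewrite -[LHS]/((linear_part f' \o linear_part f) z).
    by rewrite -linear_part_comp /linear_part /= ?fK ?subr0 //; apply: aW.
  move=> z; rewrite -[LHS]/((linear_part f \o linear_part f') z).
  by rewrite -linear_part_comp /linear_part /= ?f'K ?subr0 //; apply: aW.
Qed.

Lemma Lin_affine W : (forall f, W f -> affine_map f) ->
  forall f, Lin W f -> affine_map f.
Proof.
move=> aW _ [f Wf <-]; have [g [t fE]] := aW f Wf.
by exists g, 0 => z; rewrite !fE linear0 add0r addrK addr0.
Qed.

End AffineGroups.

(** * Lower bound on the number of reflections *)

Section LowerBound.
Variable K : fieldType.

Lemma dimv_lker_ge (X Y : vectType K) (psi : 'Hom(X, Y)) (U : {vspace X}) :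
  (\dim (limg psi) <= 1 -> \dim U <= (\dim (U :&: lker psi)).+1)%N.
Proof.
move=> psi1; rewrite -(limg_ker_dim psi U) -addn1 leq_add2l.
by apply: leq_trans psi1; rewrite dimvS ?limgS ?subvf.
Qed.

Lemma common_kernel_vector (X Y : vectType K) k (psi : 'I_k -> 'Hom(X, Y)) :
    (forall i, \dim (limg (psi i)) <= 1)%N -> (k < \dim {:X})%N ->
  exists2 x, x != 0 & forall i, psi i x = 0.
Proof.
move=> psi1 lt_k.
have dim_cap (r : seq 'I_k) :
    (\dim {:X} <= \dim (\bigcap_(i <- r) lker (psi i))%VS + size r)%N.
  elim: r => [|i r IHr]; first by rewrite big_nil addn0.
  apply: leq_trans IHr _; rewrite big_cons capvC /= addnS -addSn leq_add2r.
  exact: dimv_lker_ge.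
have {dim_cap} := dim_cap (enum 'I_k); rewrite size_enum_ord => dim_cap.
have: (\bigcap_(i <- enum 'I_k) lker (psi i))%VS != 0%VS.
  apply/eqP=> cap0; move: dim_cap; rewrite cap0 dimv0 add0n.
  by rewrite leqNgt lt_k.
rewrite -vpick0 => nz.
exists (vpick (\bigcap_(i <- enum 'I_k) lker (psi i))%VS) => // i.
have := memv_pick (\bigcap_(i <- enum 'I_k) lker (psi i))%VS.
rewrite big_enum => /subv_bigcapP xP; apply/eqP; rewrite -memv_ker memvE.
exact: xP.
Qed.

Variables (vT : vectType K) (J : finType) (c : J -> {additive vT -> vT}).

(** For [J = bool], [c false] and [c true] are the two real coordinates of a vector
    with respect to [1] and [alpha], [w] is a real vector, and [e] lists [w] and
    [alpha w]; for [J] empty this is the bound for linear groups.  The space [X]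
    below is [vT] with one extra coordinate for each element of [J]. *)
Theorem reflection_count_ge (W : set (vT -> vT)) (w : vT) (e : J -> vT) k :
    is_transformation_group W -> (forall f, W f -> affine_map f) ->
    (forall f j x, W f -> c j (linear_part f x) = linear_part f (c j x)) ->
    (forall z, (forall f, W f -> linear_part f z = z) -> z = 0) ->
    w != 0 -> (forall i j, c i (e j) = w *+ (i == j)) ->
    (forall j, W (fun z => z + e j)) ->
  generated_by_reflections W k -> (dim vT + #|J| <= k)%N.
Proof.
move=> [W1 WM WV] aW cW fixW nz_w ceE We [s [srefl sW]].
rewrite leqNgt; apply/negP => lt_k.
have Ws i : W (s i) by rewrite -sW => H [_ sH]; apply: sH; exists i.
have /choice[p /choice[H HP]] i : exists p, exists H : {vspace vT},
    (\dim H).+1 = \dim {:vT} /\ forall h, h \in H -> s i (p + h) = p + h.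
  by case: (srefl i).
pose X : vectType K := (vT * {ffun J -> K^o})%type.
have dimX : \dim {:X} = (dim vT + #|J|)%N.
  by rewrite dimvf -[#|J|]muln1.
pose shift i (x : X) := x.1 - \sum_j x.2 j *: c j (p i).
have shift_lin i : linear (shift i).
  move=> a x y; rewrite /shift /= scalerBr addrACA -opprD scaler_sumr -big_split.
  congr (_ - _); apply: eq_bigr => j _ /=.
  by rewrite !ffunE scalerDl scalerA.
pose shiftL i : {linear X -> vT} :=
  HB.pack (shift i) (GRing.isLinear.Build _ _ _ _ _ (shift_lin i)).
(* [\1 - projv H] maps into a complement of [H], which is a line, so [psi i] has
   rank at most one; its kernel consists of the [x] with [shift i x \in H i] *)
pose psi i : 'Hom(X, vT) := ((\1 - projv (H i)) \o linfun (shiftL i))%VF.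
have psiE i x : psi i x = shift i x - projv (H i) (shift i x).
  by rewrite comp_lfunE add_lfunE opp_lfunE id_lfunE lfunE.
have psi1 i : (\dim (limg (psi i)) <= 1)%N.
  have [dimH _] := HP i.
  have -> : 1%N = \dim (H i)^C by rewrite dimv_compl -dimH subSnn.
  apply: dimvS; apply/subvP=> _ /memv_imgP[x _ ->].
  by rewrite psiE memv_projC.
have [|[z u] nz_x x0] := common_kernel_vector psi1; first by rewrite dimX.
(* the extra coordinates make [f |-> cocycle f] a crossed homomorphism, and
   [Inv f] says that [f] fixes the vector [(z, u)] *)
pose cocycle (f : vT -> vT) := \sum_j u j *: c j (f 0).
pose Inv f := W f /\ linear_part f z + cocycle f = z.
have cocycle_sum f : W f -> forall y : vT,
    linear_part f (\sum_j u j *: c j y) = \sum_j u j *: c j (linear_part f y).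
  move=> Wf y; rewrite (big_morph _ (linear_partD (aW f Wf)) (linear_part0 f)).
  by apply: eq_bigr => j _; rewrite linear_partZ ?cW //; apply: aW.
have cocycle_comp f h : W f -> W h ->
    cocycle (f \o h) = linear_part f (cocycle h) + cocycle f.
  move=> Wf Wh; rewrite cocycle_sum // -big_split; apply: eq_bigr => j _ /=.
  by rewrite -scalerDr -raddfD /linear_part subrK.
have cocycle_id : cocycle id = 0.
  by rewrite /cocycle big1 // => j _; rewrite raddf0 scaler0.
have Inv_group : is_transformation_group Inv.
  split.
  - by split; rewrite // cocycle_id /linear_part subr0 addr0.
  - move=> f h [Wf fz] [Wh hz]; split; first exact: WM.
    rewrite cocycle_comp // linear_part_comp; last exact: aW.
    by rewrite addrA -linear_partD ?hz ?fz //; apply: aW.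
  - move=> f [Wf fz]; have [f' [Wf' fK f'K]] := WV f Wf.
    exists f'; split=> //; split=> //.
    have f'f : f' \o f = id by apply/funext.
    rewrite -{1}fz linear_partD; last exact: aW.
    rewrite -[linear_part f' (linear_part f z)]/((linear_part f' \o linear_part f) z).
    rewrite -linear_part_comp; last exact: aW.
    rewrite -addrA -cocycle_comp // f'f cocycle_id addr0.
    exact: subr0.
have Inv_s i : Inv (s i).
  split=> //; have [_ Hfix] := HP i.
  have hH : shift i (z, u) \in H i.
    have := x0 i; rewrite psiE => /subr0_eq ->; exact: memv_proj.
  have -> : z = \sum_j u j *: c j (p i) + shift i (z, u) by rewrite addrC subrK.
  set h := shift i (z, u) in hH *.
  have -> : linear_part (s i) (\sum_j u j *: c j (p i) + h) =
      \sum_j u j *: c j (linear_part (s i) (p i)) + h.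
    rewrite linear_partD ?cocycle_sum //; last exact: aW.
    have -> : linear_part (s i) h = linear_part (s i) ((p i + h) - p i).
      by rewrite addrAC subrr add0r.
    rewrite linear_partB; last exact: aW.
    have := Hfix 0 (mem0v _); rewrite addr0 => ->; rewrite Hfix //.
    by rewrite [p i + h]addrC addrK.
  rewrite addrAC -big_split; congr (_ + _); apply: eq_bigr => j _ /=.
  rewrite -scalerDr -raddfD /linear_part subrK.
  by have := Hfix 0 (mem0v _); rewrite addr0 => ->.
have Inv_W f : W f -> linear_part f z + cocycle f = z.
  rewrite -sW => /(_ Inv) []; last by [].
  by split=> // _ [i _ <-].
have u0 : u = 0.
  apply/ffunP => j; rewrite ffunE; apply/eqP.
  have := Inv_W _ (We j); rewrite /linear_part /cocycle add0r addrK.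
  move/eqP; rewrite -[X in _ == X]addr0 (inj_eq (addrI z)) (bigD1 j) //= big1.
    by rewrite addr0 ceE eqxx scaler_eq0 (negPf nz_w) orbF.
  by move=> l nlj; rewrite ceE (negPf nlj) scaler0.
have z0 : z = 0.
  apply: fixW => f Wf; rewrite -[RHS](Inv_W f Wf) /cocycle u0 big1 ?addr0 //.
  by move=> j _; rewrite ffunE scale0r.
by move: nz_x; rewrite u0 z0 eqxx.
Qed.

End LowerBound.

(** * Reflections and translations as generators *)

Section Generation.
Variables (K : fieldType) (vT : vectType K).
Implicit Types (G H : set (vT -> vT)) (t : vT).

(** With [l r = - 2], the map negates the complement [r] of the kernel of [l], so
    its square is the identity; it fixes the hyperplane [l = - a], which passes
    through [(a / 2) *: r]. *)
Lemma reflection_rank1 (l : vT -> K^o) (r : vT) (a : K) :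
    (2 : K) != 0 -> linear l -> l r = - 2 ->
  reflection (fun z => z + (l z + a) *: r).
Proof.
move=> nz2 l_lin lr.
have [lL lE] : exists lL : {linear vT -> K^o}, l =1 lL.
  pose lL : {linear vT -> K^o} := HB.pack l (GRing.isLinear.Build _ _ _ _ _ l_lin).
  by exists lL.
have {lr} lr : lL r = - 2 by rewrite -lE.
have gl : linear (fun z => z + l z *: r).
  move=> x y z; rewrite l_lin scalerDr scalerDl scalerA -!addrA; congr (_ + _).
  by rewrite addrCA.
pose gL : {linear vT -> vT} :=
  HB.pack (fun z => z + l z *: r) (GRing.isLinear.Build _ _ _ _ _ gl).
split.
- by exists (linfun gL), (a *: r) => z; rewrite lfunE /= scalerDl addrA.
- move=> /funeqP fid.
  have := fid 0; rewrite add0r lE linear0 add0r => ar0.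
  have := fid r; rewrite lE scalerDl ar0 addr0 => /eqP.
  rewrite -[X in _ == X]addr0 (inj_eq (addrI r)) lr scaler_eq0 oppr_eq0 (negPf nz2).
  by move=> /eqP r0; move: nz2; rewrite -oppr_eq0 -lr r0 linear0 eqxx.
- exists 2%N => // z; rewrite /= !lE linearD linearZ /= lr -addrA -scalerDl.
  rewrite [X in X *: r](_ : _ = 0) ?scale0r ?addr0 //.
  by rewrite -[_ *: - 2]/(_ * - 2); ring.
- exists ((a / 2) *: r), (lker (linfun lL)); split.
    have := limg_ker_dim (linfun lL) fullv; rewrite capfv => <-.
    rewrite -addn1; congr (_ + _)%N; apply/esym/eqP.
    have img1 : \dim {:K^o} = 1%N by rewrite dimvf.
    rewrite eqn_leq -{1}img1 dimvS ?subvf //= lt0n dimv_eq0.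
    apply: contraNneq nz2 => img0.
    have: linfun lL r \in limg (linfun lL) by rewrite memv_img ?memvf.
    by rewrite img0 memv0 lfunE /= lr oppr_eq0.
  move=> h; rewrite memv_ker lfunE /= => /eqP lh.
  rewrite lE linearD linearZ /= lh lr addr0.
  rewrite [X in _ + X *: r](_ : _ = 0) ?scale0r ?addr0 //.
  by rewrite -[_ *: - 2]/(_ * - 2); field.
Qed.

(** Families over any finite type are allowed, so that the number of generators
    can be read off from the way in which they are listed. *)
Lemma generated_by_family (I : finType) (s : I -> vT -> vT) G :
    (forall i, reflection (s i)) -> is_transformation_group G ->
    (forall i, G (s i)) ->
    (forall H, is_transformation_group H -> (forall i, H (s i)) -> G `<=` H) ->
  generated_by_reflections G #|I|.
Proof.
move=> srefl Ggrp Gs Gmin; exists (s \o enum_val); split=> [i|]; first exact: srefl.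
apply/seteqP; split=> [f sf|f Gf H [Hgrp Hs]].
  by apply: sf; split=> // _ [i _ <-]; apply: Gs.
apply: Gmin Gf => // i; apply: Hs; exists (enum_rank i) => //=.
by rewrite enum_rankK.
Qed.

Definition translation t : vT -> vT := fun z => z + t.

Lemma translation_sub H t t' : is_transformation_group H ->
  H (translation t) -> H (translation t') -> H (translation (t - t')).
Proof.
move=> [H1 HM HV] Ht Ht'; have [f [Hf _ fK]] := HV _ Ht'.
rewrite (_ : translation (t - t') = translation t \o f); first exact: HM.
by apply/funext=> z; rewrite -[in LHS](fK z) /translation /= addrACA subrr addr0.
Qed.

Lemma translation0 H : is_transformation_group H -> H (translation 0).
Proof.
by move=> [H1 _ _]; rewrite (_ : translation 0 = id) //; apply/funext=> z; apply: addr0.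
Qed.

Lemma translation_opp H t : is_transformation_group H ->
  H (translation t) -> H (translation (- t)).
Proof.
by move=> Hg Ht; rewrite -sub0r; apply: translation_sub => //; apply: translation0.
Qed.

Lemma translation_add H t t' : is_transformation_group H ->
  H (translation t) -> H (translation t') -> H (translation (t + t')).
Proof.
move=> Hg Ht Ht'; rewrite -[t']opprK.
by apply: translation_sub => //; apply: translation_opp.
Qed.

Lemma translation_sum H (I : Type) (r : seq I) (t : I -> vT) :
  is_transformation_group H -> (forall i, H (translation (t i))) ->
  H (translation (\sum_(i <- r) t i)).
Proof.
move=> Hg Ht; elim/big_rec: _ => [|i u _ Hu]; first exact: translation0.
exact: translation_add.
Qed.

Lemma translation_mulrz H t (a : int) : is_transformation_group H ->
  H (translation t) -> H (translation (t *~ a)).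
Proof.
move=> Hg Ht; have Hn n : H (translation (t *+ n)).
  elim: n => [|n IHn]; first by rewrite mulr0n; apply: translation0.
  by rewrite mulrS; apply: translation_add.
by case: a => n; rewrite ?NegzE ?mulrNz; [| apply: translation_opp => //]; apply: Hn.
Qed.

(** The linear parts of a group permute its translations, by conjugation. *)
Lemma translation_conj H f t : is_transformation_group H -> affine_map f ->
  H f -> H (translation t) -> H (translation (linear_part f t)).
Proof.
move=> [_ HM HV] af Hf Ht; have [f' [Hf' _ f'K]] := HV _ Hf.
rewrite (_ : translation _ = f \o (translation t \o f')).
  by apply: (HM) => //; apply: HM.
apply/funext=> z /=; have := linear_partB (translation t (f' z)) (f' z) af.
by rewrite /translation /= addrAC subrr add0r f'K => ->; rewrite addrC subrK.
Qed.

End Generation.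

(** * Counting reflections in a crystallographic group *)

Section MinimalCount.
Variables (K : fieldType) (vT : vectType K) (c : bool -> {additive vT -> vT}).

(** Under the hypotheses of the lower bound, generating sets of the right size are
    all that remains to be found. *)
Theorem min_reflections_crystal (W : set (vT -> vT)) (w : vT) (e : bool -> vT) d :
    dim vT = d -> is_transformation_group W -> (forall f, W f -> affine_map f) ->
    (forall f b x, W f -> c b (linear_part f x) = linear_part f (c b x)) ->
    (forall z, (forall f, W f -> linear_part f z = z) -> z = 0) ->
    w != 0 -> (forall b b', c b (e b') = w *+ (b == b')) ->
    (forall b, W (translation (e b))) ->
    generated_by_reflections (Lin W) d ->
    generated_by_reflections W (d + 2) ->
  min_reflections (Lin W) d /\ min_reflections W (d + 2).
Proof.
move=> <- Wgrp aW cW fixW nz_w ceE We genL genW; split; split=> // k.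
  rewrite -[X in _ -> (X <= _)%N]addn0 -card_void.
  pose noc (v : void) : {additive vT -> vT} := of_void _ v.
  apply: (@reflection_count_ge _ _ _ noc (Lin W) w (of_void _)) => //.
  - exact: Lin_is_group.
  - exact: Lin_affine.
  - move=> z fixz; apply: fixW => f Wf.
    have <- : linear_part (linear_part f) z = linear_part f z.
      by rewrite {1}/linear_part linear_part0 subr0.
    by apply: fixz; exists f.
by rewrite -card_bool; apply: (reflection_count_ge (c := c) (w := w)).
Qed.

End MinimalCount.

(** * The period lattice and its coordinates *)

Section Lattice.
Variables (R : realType) (alpha : R[i]).

Definition lattice_basis (b : bool) : R[i] := if b then alpha else 1.

(** [y] is the real number for which [z - y * alpha] is real. *)
Definition lattice_coord (b : bool) (z : R[i]) : R[i] :=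
  let y := complex.Im z / complex.Im alpha in
  (if b then y else complex.Re z - y * complex.Re alpha)%:C.

Fact lattice_coord_is_zmod_morphism b : zmod_morphism (lattice_coord b).
Proof.
by move=> [x1 y1] [x2 y2]; rewrite /lattice_coord -rmorphB; case: b;
  congr (_%:C) => /=; ring.
Qed.

HB.instance Definition _ b :=
  GRing.isZmodMorphism.Build _ _ (lattice_coord b) (lattice_coord_is_zmod_morphism b).

Lemma lattice_coord_basis b b' : complex.Im alpha != 0 ->
  lattice_coord b (lattice_basis b') = (b == b')%:R.
Proof.
rewrite /lattice_coord /lattice_basis; case: alpha => x y /= nz_y.
by case: b; case: b'; rewrite /= ?mul0r ?divff // ?mul1r ?subrr ?subr0 ?rmorph0 ?rmorph1.
Qed.

Lemma lattice_coord_basisM b b' (x : bool) : complex.Im alpha != 0 ->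
  lattice_coord b (lattice_basis b' * x%:R) = (b == b')%:R * x%:R.
Proof.
by move=> nz_alpha; case: x; rewrite /= ?mulr1 ?mulr0 ?raddf0 ?lattice_coord_basis.
Qed.

Lemma period_lattice_basis b : period_lattice alpha (lattice_basis b).
Proof.
by case: b; [exists 0, 1 | exists 1, 0]; rewrite ?mul0r ?mul1r ?add0r ?addr0.
Qed.

Lemma period_latticeN z : period_lattice alpha z -> period_lattice alpha (- z).
Proof.
by move=> [a [b ->]]; exists (- a), (- b); rewrite !mulrNz mulNr opprD.
Qed.

Lemma period_latticeD z z' : period_lattice alpha z -> period_lattice alpha z' ->
  period_lattice alpha (z + z').
Proof.
move=> [a [b ->]] [a' [b' ->]]; exists (a + a'), (b + b').
by rewrite !mulrzDr mulrDl addrACA.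
Qed.

Lemma translation_lattice (vT : vectType R[i]) (H : set (vT -> vT)) (v : vT) z :
    is_transformation_group H ->
    (forall b, H (translation (lattice_basis b *: v))) ->
  period_lattice alpha z -> H (translation (z *: v)).
Proof.
move=> Hg Hv [a [b ->]]; rewrite scalerDl -scalerA !scaler_int.
apply: translation_add => //; apply: translation_mulrz => //; last exact: (Hv true).
by rewrite -[v]scale1r; apply: (Hv false).
Qed.

End Lattice.

(** * The groups of signed permutations *)

(** An induction principle, because the transpositions moving one given point
    generate the symmetric group. *)
Lemma tperm0_ind n (Q : 'S_n.+1 -> Prop) :
    Q 1%g -> (forall i, i != ord0 -> Q (tperm ord0 i)) ->
    (forall s s', Q s -> Q s' -> Q (s * s')%g) ->
  forall s, Q s.
Proof.
move=> Q1 Qt QM s; have := finset.in_setT s; rewrite -(gen_tperm ord0).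
case/gen_prodgP => k [a a_gen ->]; elim/big_ind: _ => // i _.
have /imsetP[j _ ->] := a_gen i.
by have [->|nz_j] := eqVneq j ord0; [rewrite tperm1 | apply: Qt].
Qed.

Section SignedPermutations.
Variables (R : realType) (n : nat).
Implicit Types (e : 'I_n -> bool) (s : 'S_n) (t z : 'cV[R[i]]_n)
  (f : 'cV[R[i]]_n -> 'cV[R[i]]_n).

Definition signed_perm e s t z : 'cV[R[i]]_n :=
  \col_i ((-1) ^+ e i * z (s i) 0 + t i 0).

Lemma signed_perm_mul e s t z :
  signed_perm e s t z = (diag_mx (\row_i (-1) ^+ e i) *m perm_mx s) *m z + t.
Proof.
apply/colP=> i; rewrite -mulmxA -row_permE !mxE; congr (_ + _).
rewrite (bigD1 i) //= !mxE eqxx mulr1n big1 ?addr0 // => j nij.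
by rewrite !mxE eq_sym (negPf nij) mulr0n mul0r.
Qed.

Lemma signed_perm_comp e s t e' s' t' :
  signed_perm e s t \o signed_perm e' s' t' =
  signed_perm (fun i => e i (+) e' (s i)) (s * s') (signed_perm e s t t').
Proof.
apply/funext=> z; apply/colP=> i; rewrite !mxE permM signr_addb.
by rewrite mulrDr mulrA addrA.
Qed.

Lemma signed_perm_id : signed_perm (fun=> false) 1 0 = id.
Proof. by apply/funext=> z; apply/colP=> i; rewrite !mxE perm1 mul1r addr0. Qed.

Lemma signed_perm_affine e s t : affine_map (signed_perm e s t).
Proof.
exists (linfun (mulmx (diag_mx (\row_i (-1) ^+ e i) *m perm_mx s))), t => z.
by rewrite lfunE signed_perm_mul.
Qed.

Lemma linear_part_signed_perm e s t :
  linear_part (signed_perm e s t) = signed_perm e s 0.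
Proof.
by apply/funext=> z; apply/colP=> i; rewrite !mxE mulr0 add0r addr0 addrK.
Qed.

Lemma signed_perm_transl e s t :
  signed_perm e s t = translation t \o signed_perm e s 0.
Proof. by apply/funext=> z; apply/colP=> i; rewrite !mxE addr0. Qed.

Variable alpha : R[i].

Lemma G21_crystalP f : G21_crystal alpha f <->
  exists e s t, (forall i, period_lattice alpha (t i 0)) /\ f = signed_perm e s t.
Proof.
split=> [[_ [t [[e [s ->]] Lt fE]]]|[e [s [t [Lt ->]]]]].
  by exists e, s, t; split=> //; apply/funext=> z; rewrite fE signed_perm_mul.
exists (diag_mx (\row_i (-1) ^+ e i) *m perm_mx s), t; split=> //; first by exists e, s.
by move=> z; rewrite signed_perm_mul.
Qed.

Lemma G21_crystal_affine f : G21_crystal alpha f -> affine_map f.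
Proof. by move=> /G21_crystalP[e [s [t [_ ->]]]]; apply: signed_perm_affine. Qed.

Lemma period_lattice_signed_perm (e : 'I_n -> bool) s t t' i :
    (forall i, period_lattice alpha (t i 0)) ->
    (forall i, period_lattice alpha (t' i 0)) ->
  period_lattice alpha (signed_perm e s t t' i 0).
Proof.
move=> Lt Lt'; rewrite mxE; apply: period_latticeD => //.
by case: (e i); rewrite ?mulN1r ?mul1r //; apply: period_latticeN.
Qed.

Lemma G21_crystal_group : is_transformation_group (@G21_crystal R n alpha).
Proof.
split.
- apply/G21_crystalP; exists (fun=> false), 1%g, 0; rewrite signed_perm_id; split=> // i.
  by rewrite mxE; apply: period_lattice0.
- move=> _ _ /G21_crystalP[e [s [t [Lt ->]]]] /G21_crystalP[e' [s' [t' [Lt' ->]]]].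
  apply/G21_crystalP; rewrite signed_perm_comp; do 3!eexists; split; last by [].
  by move=> i; apply: period_lattice_signed_perm.
- move=> _ /G21_crystalP[e [s [t [Lt ->]]]].
  pose e' i := e (s^-1 i)%g; pose u := signed_perm e' s^-1 0 (- t).
  have L0 i : period_lattice alpha ((0 : 'cV[R[i]]_n) i 0).
    by rewrite mxE; apply: period_lattice0.
  have LNt i : period_lattice alpha ((- t) i 0).
    by rewrite mxE; apply: period_latticeN.
  exists (signed_perm e' s^-1 u); split.
  + apply/G21_crystalP; exists e', s^-1%g, u; split=> // i.
    exact: period_lattice_signed_perm.
  + move=> z; apply/colP=> i; rewrite !mxE /e' permKV addr0 mulrN.
    by case: (e _); ring.
  + move=> z; apply/colP=> i; rewrite !mxE /e' permK addr0.
    by case: (e _); ring.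
Qed.

Lemma lattice_coord_signed_perm f b z : G21_crystal alpha f ->
  map_mx (lattice_coord alpha b) (linear_part f z) =
  linear_part f (map_mx (lattice_coord alpha b) z).
Proof.
move=> /G21_crystalP[e [s [t [_ ->]]]]; rewrite linear_part_signed_perm.
apply/colP=> i; rewrite !mxE !addr0.
by case: (e i); rewrite ?mulN1r ?raddfN // !mul1r.
Qed.

(** The group contains [-1]. *)
Lemma G21_crystal_fix z :
  (forall f, G21_crystal alpha f -> linear_part f z = z) -> z = 0.
Proof.
move=> fix_z; have: linear_part (signed_perm (fun=> true) 1 0) z = z.
  apply: fix_z; apply/G21_crystalP; exists (fun=> true), 1%g, 0; split=> // i.
  by rewrite mxE; apply: period_lattice0.
rewrite linear_part_signed_perm => /colP zN; apply/colP=> i; apply/eqP.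
have := zN i; rewrite !mxE perm1 mulN1r addr0 => /eqP.
by rewrite eq_sym -addr_eq0 -mulr2n mulrn_eq0.
Qed.

End SignedPermutations.

Section SignedPermutationGenerators.
Variables (R : realType) (n : nat) (alpha : R[i]).
Notation V := 'cV[R[i]]_n.+1.
Implicit Types (H : set (V -> V)).

Local Notation unit_vector i := (delta_mx i 0 : V).

Definition sign0 (e : bool) : 'I_n.+1 -> bool := fun k => e && (k == ord0).

(** The value at [0], where the transposition is trivial, is the sign change of the
    first coordinate; the other values are the transpositions [(0 i)].  There is
    thus exactly one generator per coordinate. *)
Definition G21_generator (i : 'I_n.+1) : V -> V :=
  signed_perm (sign0 (i == ord0)) (tperm ord0 i) 0.

Definition G21_affine_generator (b : bool) : V -> V :=
  signed_perm (sign0 true) 1 (lattice_basis alpha b *: unit_vector ord0).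

Lemma sign_change_reflection a :
  reflection (signed_perm (sign0 true) 1 (a *: unit_vector ord0) : V -> V).
Proof.
have -> : signed_perm (sign0 true) 1 (a *: unit_vector ord0) =
    (fun z => z + (- 2 * z ord0 0 + a) *: unit_vector ord0).
  apply/funext=> z; apply/colP=> i; rewrite !mxE perm1 /sign0 /= andbT.
  by case: eqVneq => [->|_] /=; rewrite ?expr0 ?expr1; ring.
apply: reflection_rank1; first by rewrite pnatr_eq0.
  by move=> x y z; rewrite !mxE -[_ *: (- 2 * _)]/(_ * (- 2 * _)); ring.
by rewrite mxE eqxx mulr1.
Qed.

Lemma swap_reflection (i : 'I_n.+1) : i != ord0 ->
  reflection (signed_perm (fun=> false) (tperm ord0 i) 0 : V -> V).
Proof.
move=> nz_i; have nz_i' := negPf nz_i; rewrite eq_sym in nz_i'.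
have -> : signed_perm (fun=> false) (tperm ord0 i) 0 =
    (fun z => z + (z i 0 - z ord0 0 + 0) *: (unit_vector ord0 - unit_vector i)).
  apply/funext=> z; apply/colP=> k; rewrite !mxE expr0 andbT.
  case: tpermP => [->|->|/eqP/negPf-> /eqP/negPf->]; rewrite ?eqxx /=; last by ring.
    by rewrite nz_i' /=; ring.
  by rewrite (negPf nz_i) /=; ring.
apply: reflection_rank1; first by rewrite pnatr_eq0.
  by move=> x y z; rewrite !mxE -[_ *: (_ - _)]/(_ * (_ - _)); ring.
by rewrite !mxE !eqxx nz_i' (negPf nz_i) /=; ring.
Qed.

Lemma G21_generator_reflection i : reflection (G21_generator i).
Proof.
rewrite /G21_generator; case: eqVneq => [->|]; last exact: swap_reflection.
by rewrite tperm1; have := sign_change_reflection 0; rewrite scale0r.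
Qed.

(** Transpositions give all permutations, and permutations carry the sign change of
    the first coordinate to that of any other one. *)
Lemma G21_generation H : is_transformation_group H ->
    (forall i, H (G21_generator i)) ->
  forall e s, H (signed_perm e s 0).
Proof.
move=> Hgrp Hgen; have [H1 HM HV] := Hgrp.
have sp00 e s : signed_perm e s 0 (0 : V) = 0.
  by apply/colP=> k; rewrite !mxE mulr0 addr0.
have Hperm s : H (signed_perm (fun=> false) s 0).
  elim/tperm0_ind: s => [|i nz_i|s s' Hs Hs']; first by rewrite signed_perm_id.
    by have := Hgen i; rewrite /G21_generator (negPf nz_i).
  by have := HM _ _ Hs Hs'; rewrite signed_perm_comp sp00.
(* a sign change at [i] is the one at the first coordinate, conjugated *)
have Hsign i : H (signed_perm (pred1 i) 1 0).
  have Hgen0 : H (signed_perm (sign0 true) 1 0).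
    by have := Hgen ord0; rewrite /G21_generator eqxx tperm1.
  have := HM _ _ (Hperm (tperm ord0 i)) (HM _ _ Hgen0 (Hperm (tperm ord0 i))).
  rewrite !signed_perm_comp !sp00 mul1g tperm2.
  congr (H (signed_perm _ _ _)); apply/funext=> k /=.
  by rewrite addbF /sign0 /= (canF_eq (tpermK _ _)) tpermL.
move=> e s; have -> : signed_perm e s 0 =
    signed_perm e 1 0 \o signed_perm (fun=> false) s 0 :> (V -> V).
  rewrite signed_perm_comp sp00 mul1g.
  by congr (signed_perm _ _ _); apply/funext=> k; rewrite addbF.
apply: (HM) => //.
(* the sign changes are composed one coordinate at a time *)
have Hseq (r : seq 'I_n.+1) : uniq r -> H (signed_perm (fun k => (k \in r) && e k) 1 0).
  elim: r => [_|i r IHr /=/andP[nri /IHr Hr]]; first by rewrite signed_perm_id.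
  have -> : signed_perm (fun k => (k \in i :: r) && e k) 1 0 =
      (if e i then signed_perm (pred1 i) 1 0 else id) \o
      signed_perm (fun k => (k \in r) && e k) 1 0 :> (V -> V).
    case ei: (e i); first rewrite signed_perm_comp sp00 mul1g;
      [congr (signed_perm _ _ _)|congr (signed_perm _ _ _)]; apply/funext=> k;
      by rewrite inE /= ?perm1; case: (eqVneq k i) => // ->; rewrite ei (negPf nri).
  by apply: HM => //; case: (e i).
have := Hseq _ (enum_uniq 'I_n.+1).
by congr (H (signed_perm _ _ _)); apply/funext=> k; rewrite mem_enum.
Qed.

Lemma Lin_G21_crystalP f : Lin (@G21_crystal R n.+1 alpha) f <->
  exists e s, f = signed_perm e s 0.
Proof.
split=> [[h /G21_crystalP[e [s [t [_ ->]]]] <-]|[e [s ->]]].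
  by exists e, s; rewrite -(linear_part_signed_perm e s t).
exists (signed_perm e s 0); last exact: linear_part_signed_perm.
apply/G21_crystalP; exists e, s, 0; split=> // i.
by rewrite mxE; apply: period_lattice0.
Qed.

(** An affine generator composed with the linear sign change is the translation by
    a multiple of the first unit vector; permutations carry it to the others. *)
Lemma G21_crystal_generation H : is_transformation_group H ->
    (forall i, H (G21_generator i)) -> (forall b, H (G21_affine_generator b)) ->
  G21_crystal alpha `<=` H.
Proof.
move=> Hgrp Hgen Haff; have [_ HM _] := Hgrp.
have Hlin := G21_generation Hgrp Hgen.
have Htr0 b : H (translation (lattice_basis alpha b *: unit_vector ord0)).
  have := HM _ _ (Haff b) (Hlin (sign0 true) 1%g).
  rewrite signed_perm_comp; congr (H _); apply/funext=> z; apply/colP=> i.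
  by rewrite /translation !mxE mulg1 !perm1 addbb mul1r mulr0 add0r.
have Htr b i : H (translation (lattice_basis alpha b *: unit_vector i)).
  pose p : V -> V := signed_perm (fun=> false) (tperm ord0 i) 0.
  have := translation_conj Hgrp (signed_perm_affine _ _ _ : affine_map p) (Hlin _ _) (Htr0 b).
  rewrite linear_part_signed_perm; congr (H (translation _)); apply/colP=> k.
  by rewrite !mxE mul1r addr0 (canF_eq (tpermK _ _)) tpermL.
move=> _ /G21_crystalP[e [s [t [Lt ->]]]].
rewrite signed_perm_transl; apply: HM => //.
have -> : t = \sum_i t i 0 *: unit_vector i.
  rewrite [LHS]matrix_sum_delta; apply: eq_bigr => i _.
  by rewrite big_ord1.
apply: translation_sum => // i; exact: translation_lattice.
Qed.

Theorem min_reflections_G21 : complex.Im alpha != 0 ->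
  min_reflections (Lin (@G21_crystal R n.+1 alpha)) n.+1 /\
  min_reflections (@G21_crystal R n.+1 alpha) (n.+1 + 2).
Proof.
move=> nz_alpha; have dimV : dim V = n.+1 by rewrite /dim /= muln1.
have Hgrp := G21_crystal_group n.+1 alpha.
have aff := @G21_crystal_affine R n.+1 alpha.
have Lin_gen i : Lin (G21_crystal alpha) (G21_generator i).
  by apply/Lin_G21_crystalP; do 2!eexists.
pose c b : {additive V -> V} := map_mx (lattice_coord alpha b).
apply: (min_reflections_crystal (c := c) (w := unit_vector ord0)
          (e := fun b => lattice_basis alpha b *: unit_vector ord0)) => //.
- by move=> f b x; apply: lattice_coord_signed_perm.
- exact: G21_crystal_fix.
- apply/eqP=> /colP/(_ ord0)/eqP; rewrite !mxE !eqxx.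
  by rewrite oner_eq0.
- move=> b b'; apply/colP=> i; rewrite mulmxnE !mxE andbT.
  by rewrite /= lattice_coord_basisM // mulr_natl.
- move=> b; apply/G21_crystalP.
  exists (fun=> false), 1%g, (lattice_basis alpha b *: unit_vector ord0); split.
    move=> i; rewrite !mxE andbT; case: eqP => _; rewrite ?mulr1 ?mulr0.
      exact: period_lattice_basis.
    exact: period_lattice0.
  by rewrite signed_perm_transl signed_perm_id.
- rewrite -[X in generated_by_reflections _ X]card_ord.
  apply: (generated_by_family (s := G21_generator)) => //.
  + exact: G21_generator_reflection.
  + exact: Lin_is_group.
  + by move=> H HH Hs _ /Lin_G21_crystalP[e [s ->]]; apply: G21_generation.
- rewrite -[X in (X + _)%N]card_ord -card_bool -card_sum.
  pose gen (x : 'I_n.+1 + bool) :=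
    match x with inl i => G21_generator i | inr b => G21_affine_generator b end.
  apply: (generated_by_family (s := gen)) => //.
  + by case=> [i|b]; [apply: G21_generator_reflection | apply: sign_change_reflection].
  + case=> [i|b]; apply/G21_crystalP; do 3!eexists; split; try reflexivity.
      by move=> k; rewrite mxE; apply: period_lattice0.
    move=> i; rewrite !mxE andbT; case: eqP => _; rewrite ?mulr1 ?mulr0.
      exact: period_lattice_basis.
    exact: period_lattice0.
  + move=> H HH Hs; apply: G21_crystal_generation => // x.
      exact: (Hs (inl x)).
    exact: (Hs (inr x)).
Qed.

End SignedPermutationGenerators.

(** * The symmetric groups on the zero-sum space *)

Section ZeroSumSpace.
Variables (R : realType) (n : nat).
Notation V := (subvs_of (zero_sum R n)).
Implicit Types (s : 'S_n) (t z : V) (f : V -> V).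

Lemma zero_sumP z : \sum_i vsval z i 0 = 0.
Proof. by apply/eqP; rewrite -mem_zero_sum subvsP. Qed.

Lemma zero_sum_ext z t : (forall i, vsval z i 0 = vsval t i 0) -> z = t.
Proof. by move=> zt; apply/val_inj/colP. Qed.

Lemma vsval_proj (x : 'cV[R[i]]_n) : \sum_i x i 0 = 0 ->
  vsval (vsproj (zero_sum R n) x) = x.
Proof. by move=> x0; apply: vsprojK; rewrite mem_zero_sum x0. Qed.

Lemma vsvalD z t i : vsval (z + t) i 0 = vsval z i 0 + vsval t i 0.
Proof. by rewrite linearD mxE. Qed.

Lemma vsvalN z i : vsval (- z) i 0 = - vsval z i 0.
Proof. by rewrite linearN mxE. Qed.

Lemma vsvalZ a z i : vsval (a *: z) i 0 = a * vsval z i 0.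
Proof. by rewrite linearZ mxE. Qed.

Lemma vsval0 i : vsval (0 : V) i 0 = 0.
Proof. by rewrite linear0 mxE. Qed.

Definition vsvalE := (vsvalD, vsvalN, vsvalZ, vsval0).

Definition perm_map s t z : V := vsproj (zero_sum R n) (perm_mx s *m vsval z) + t.

Lemma vsval_perm_map s t z :
  vsval (perm_map s t z) = perm_mx s *m vsval z + vsval t.
Proof.
rewrite [LHS]linearD /= vsval_proj // -[RHS](zero_sumP z) [RHS](reindex_inj (@perm_inj _ s)).
by apply: eq_bigr => i _; rewrite -row_permE mxE.
Qed.

Lemma perm_mapE s t z i : vsval (perm_map s t z) i 0 = vsval z (s i) 0 + vsval t i 0.
Proof. by rewrite vsval_perm_map -row_permE !mxE. Qed.

Lemma perm_map_comp s t s' t' :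
  perm_map s t \o perm_map s' t' = perm_map (s * s') (perm_map s t t').
Proof.
by apply/funext=> z; apply: zero_sum_ext => i; rewrite !perm_mapE permM addrA.
Qed.

Lemma perm_map_id : perm_map 1 0 = id.
Proof.
by apply/funext=> z; apply: zero_sum_ext => i; rewrite perm_mapE perm1 vsval0 addr0.
Qed.

Lemma perm_map_affine s t : affine_map (perm_map s t).
Proof.
have lin : linear (perm_map s 0).
  by move=> a x y; apply: zero_sum_ext => i; rewrite !(vsvalE, perm_mapE) !addr0.
pose g : {linear V -> V} := HB.pack (perm_map s 0) (GRing.isLinear.Build _ _ _ _ _ lin).
by exists (linfun g), t => z; rewrite lfunE /= /perm_map addr0.
Qed.

Lemma linear_part_perm_map s t : linear_part (perm_map s t) = perm_map s 0.
Proof.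
apply/funext=> z; apply: zero_sum_ext => i.
by rewrite /linear_part !(vsvalE, perm_mapE) add0r addr0 addrK.
Qed.

Lemma perm_map_transl s t : perm_map s t = translation t \o perm_map s 0.
Proof. by apply/funext=> z; rewrite /translation /perm_map /= addr0. Qed.

Definition root i j : V := vsproj (zero_sum R n) (delta_mx i 0 - delta_mx j 0).

Lemma rootE i j k : vsval (root i j) k 0 = (k == i)%:R - (k == j)%:R.
Proof.
rewrite vsval_proj ?mxE ?andbT //.
rewrite (eq_bigr (fun k => (k == i)%:R - (k == j)%:R)) => [|l _]; last first.
  by rewrite !mxE !andbT.
have sum1 l : \sum_k ((k == l)%:R : R[i]) = 1.
  by rewrite (bigD1 l) //= eqxx big1 ?addr0 // => m /negPf->.
by rewrite sumrB !sum1 subrr.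
Qed.

(* [rootE] is the only property of [root] used below *)
#[global] Opaque root.

Variable alpha : R[i].

Lemma A_crystalP f : A_crystal alpha f <->
  exists s t, (forall i, period_lattice alpha (vsval t i 0)) /\ f = perm_map s t.
Proof.
split=> [[s [t [Lt fE]]]|[s [t [Lt ->]]]]; exists s, t; split=> //.
  by apply/funext=> z; apply/val_inj; rewrite [LHS]fE -vsval_perm_map.
by move=> z; apply: vsval_perm_map.
Qed.

Lemma A_crystal_affine f : A_crystal alpha f -> affine_map f.
Proof. by move=> /A_crystalP[s [t [_ ->]]]; apply: perm_map_affine. Qed.

Lemma period_lattice_vsval0 i : period_lattice alpha (vsval (0 : V) i 0).
Proof. by rewrite vsval0; apply: period_lattice0. Qed.

Lemma A_crystal_perm s : A_crystal alpha (perm_map s 0).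
Proof. by apply/A_crystalP; exists s, 0; split=> // i; apply: period_lattice_vsval0. Qed.

Lemma A_crystal_group : is_transformation_group (@A_crystal R n alpha).
Proof.
split.
- by rewrite -perm_map_id; apply: A_crystal_perm.
- move=> _ _ /A_crystalP[s [t [Lt ->]]] /A_crystalP[s' [t' [Lt' ->]]].
  apply/A_crystalP; rewrite perm_map_comp; do 2!eexists; split; last by [].
  by move=> i; rewrite perm_mapE; apply: period_latticeD.
- move=> _ /A_crystalP[s [t [Lt ->]]]; pose u := - perm_map s^-1 0 t.
  exists (perm_map s^-1 u); split.
  + apply/A_crystalP; exists s^-1%g, u; split=> // i.
    by rewrite vsvalN perm_mapE vsval0 addr0; apply: period_latticeN.
  + move=> z; apply: zero_sum_ext => i; rewrite !(vsvalE, perm_mapE) permKV.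
    by rewrite addr0 addrK.
  + move=> z; apply: zero_sum_ext => i; rewrite !(vsvalE, perm_mapE) permK.
    by rewrite addr0 subrK.
Qed.

Definition zero_sum_coord b : {additive V -> V} :=
  vsproj (zero_sum R n) \o map_mx (lattice_coord alpha b) \o vsval.

Lemma zero_sum_coordE b z i :
  vsval (zero_sum_coord b z) i 0 = lattice_coord alpha b (vsval z i 0).
Proof.
rewrite vsval_proj ?mxE //.
rewrite (eq_bigr (fun i => lattice_coord alpha b (vsval z i 0))) => [|j _].
  by rewrite -raddf_sum zero_sumP raddf0.
by rewrite mxE.
Qed.

Lemma zero_sum_coord_perm f b z : A_crystal alpha f ->
  zero_sum_coord b (linear_part f z) = linear_part f (zero_sum_coord b z).
Proof.
move=> /A_crystalP[s [t [_ ->]]]; rewrite linear_part_perm_map.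
apply: zero_sum_ext => i.
by rewrite !(perm_mapE, zero_sum_coordE) vsval0 !addr0.
Qed.

(** A vector fixed by all transpositions has equal coordinates, so they vanish
    when their sum does. *)
Lemma A_crystal_fix z :
  (forall f, A_crystal alpha f -> linear_part f z = z) -> z = 0.
Proof.
move=> fix_z; apply: zero_sum_ext => i; rewrite vsval0; apply/eqP.
have zE j : vsval z j 0 = vsval z i 0.
  have := fix_z _ (A_crystal_perm (tperm i j)); rewrite linear_part_perm_map.
  move/(congr1 (fun x : V => vsval x i 0)).
  by rewrite perm_mapE tpermL vsval0 addr0.
have := zero_sumP z; rewrite (eq_bigr _ (fun j _ => zE j)) sumr_const card_ord.
move/eqP; rewrite mulrn_eq0 => /orP[/eqP n0|//].
by have := ltn_ord i; rewrite {2}n0.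
Qed.

End ZeroSumSpace.

Section PermutationGenerators.
Variables (R : realType) (n : nat) (alpha : R[i]).
Notation V := (subvs_of (zero_sum R n.+2)).
Implicit Types (f : V -> V) (H : set (V -> V)).

Lemma dim_zero_sum : dim V = n.+1.
Proof.
rewrite -[LHS]/(\dim (zero_sum R n.+2)).
have := limg_ker_dim (linfun (mulmx (const_mx 1 : 'rV[R[i]]_n.+2)) : 'Hom('cV_n.+2, 'M_1)) fullv.
rewrite capfv dimvf /dim /= muln1.
set L := linfun _; have -> : \dim (limg L) = 1%N.
  apply/eqP; rewrite eqn_leq; apply/andP; split.
    by apply: leq_trans (dimvS (subvf _)) _; rewrite dimvf.
  rewrite lt0n dimv_eq0; apply/eqP=> L0.
  have: L (delta_mx ord0 0) \in limg L by rewrite memv_img ?memvf.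
  rewrite L0 memv0 lfunE /= => /eqP/matrixP/(_ 0 0)/eqP.
  rewrite !mxE (bigD1 ord0) //= !mxE eqxx mul1r big1 ?addr0 ?oner_eq0 // => i ni0.
  by rewrite !mxE (negPf ni0) mulr0.
by rewrite addn1 => -[].
Qed.

Lemma A_reflection (i : 'I_n.+2) a : i != ord0 ->
  reflection (perm_map (tperm ord0 i) (a *: root R ord0 i) : V -> V).
Proof.
move=> nz_i; have nz_i' := negPf nz_i; rewrite eq_sym in nz_i'.
have -> : perm_map (tperm ord0 i) (a *: root R ord0 i) =
    (fun z : V => z + (vsval z i 0 - vsval z ord0 0 + a) *: root R ord0 i).
  apply/funext=> z; apply: zero_sum_ext => k.
  rewrite [LHS]perm_mapE [RHS]vsvalD 2!vsvalZ rootE.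
  case: tpermP => [->|->|/eqP/negPf-> /eqP/negPf->]; rewrite ?eqxx /=; last by ring.
    by rewrite nz_i' /=; ring.
  by rewrite (negPf nz_i) /=; ring.
apply: reflection_rank1; first by rewrite pnatr_eq0.
  by move=> x y z; rewrite !vsvalE -[_ *: (_ - _)]/(_ * (_ - _)); ring.
by rewrite !rootE !eqxx nz_i' (negPf nz_i) /=; ring.
Qed.

Definition A_generator (i : 'I_n.+1) : V -> V := perm_map (tperm ord0 (lift ord0 i)) 0.

Definition A_affine_generator (b : bool) : V -> V :=
  perm_map (tperm ord0 (lift ord0 ord0))
    (lattice_basis alpha b *: root R ord0 (lift ord0 ord0)).

Lemma A_generation H : is_transformation_group H -> (forall i, H (A_generator i)) ->
  forall s, H (perm_map s 0).
Proof.
move=> [H1 HM _] Hgen; elim/tperm0_ind=> [|i nz_i|s s' Hs Hs'].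
- by rewrite perm_map_id.
- case: (unliftP ord0 i) nz_i => [j ->|->]; last by rewrite eqxx.
  by move=> _; apply: Hgen.
- have := HM _ _ Hs Hs'; rewrite perm_map_comp; congr (H (perm_map _ _)).
  by apply: zero_sum_ext => i; rewrite perm_mapE !vsval0 addr0.
Qed.

Lemma Lin_A_crystalP f : Lin (@A_crystal R n.+2 alpha) f <-> exists s, f = perm_map s 0.
Proof.
split=> [[h /A_crystalP[s [t [_ ->]]] <-]|[s ->]].
  by exists s; rewrite -(linear_part_perm_map s t).
by exists (perm_map s 0); [apply: A_crystal_perm | apply: linear_part_perm_map].
Qed.

(** An affine generator composed with the transposition that is its linear part
    is the translation by a multiple of the difference of the first two unit
    vectors.  Permutations fixing the first coordinate carry it to the multiples
    of all [root ord0 i], and these span the zero-sum vectors. *)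
Lemma A_crystal_generation H : is_transformation_group H ->
    (forall i, H (A_generator i)) -> (forall b, H (A_affine_generator b)) ->
  A_crystal alpha `<=` H.
Proof.
move=> Hgrp Hgen Haff; have [_ HM _] := Hgrp.
have Hlin := A_generation Hgrp Hgen; set j1 : 'I_n.+2 := lift ord0 ord0.
have Htr1 b : H (translation (lattice_basis alpha b *: root R ord0 j1)).
  have := HM _ _ (Haff b) (Hlin (tperm ord0 j1)).
  rewrite perm_map_comp; congr (H _); apply/funext=> z; apply: zero_sum_ext => i.
  by rewrite /translation !(perm_mapE, vsvalE) tperm2 perm1 add0r.
have Htr b i : H (translation (lattice_basis alpha b *: root R ord0 i)).
  have [->|nz_i] := eqVneq i ord0.
    rewrite (_ : root R ord0 ord0 = 0) ?scaler0; first exact: translation0.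
    by apply: zero_sum_ext => k; rewrite rootE subrr vsval0.
  have := translation_conj Hgrp (perm_map_affine (tperm j1 i) 0) (Hlin _) (Htr1 b).
  rewrite linear_part_perm_map; congr (H (translation _)); apply: zero_sum_ext => k.
  rewrite !(vsvalE, perm_mapE, rootE) addr0 !(canF_eq (tpermK _ _)) tpermL.
  by rewrite tpermD.
move=> _ /A_crystalP[s [t [Lt ->]]].
rewrite perm_map_transl; apply: HM => //.
have -> : t = \sum_i (- vsval t i 0) *: root R ord0 i.
  apply: zero_sum_ext => k; rewrite linear_sum summxE.
  rewrite (eq_bigr (fun i => vsval t i 0 * (k == i)%:R - vsval t i 0 * (k == ord0)%:R)).
    rewrite sumrB -mulr_suml zero_sumP mul0r subr0 (bigD1 k) //= eqxx mulr1 big1 ?addr0 //.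
    by move=> i nik; rewrite eq_sym (negPf nik) mulr0.
  by move=> i _; rewrite vsvalZ rootE; ring.
apply: translation_sum => // i; apply: translation_lattice => //.
exact: period_latticeN.
Qed.

Theorem min_reflections_A : complex.Im alpha != 0 ->
  min_reflections (Lin (@A_crystal R n.+2 alpha)) n.+1 /\
  min_reflections (@A_crystal R n.+2 alpha) (n.+1 + 2).
Proof.
move=> nz_alpha.
have Hgrp := A_crystal_group n.+2 alpha.
have aff := @A_crystal_affine R n.+2 alpha.
pose j1 : 'I_n.+2 := lift ord0 ord0.
have Lbasis b i : period_lattice alpha
    (vsval (lattice_basis alpha b *: root R ord0 j1) i 0).
  rewrite vsvalZ rootE mulrBr; apply: period_latticeD; last apply: period_latticeN;
    case: eqP => _; rewrite ?mulr1 ?mulr0;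
    by [apply: period_lattice_basis | apply: period_lattice0].
apply: (min_reflections_crystal (c := zero_sum_coord n.+2 alpha) (w := root R ord0 j1)
          (e := fun b => lattice_basis alpha b *: root R ord0 j1)) => //.
- exact: dim_zero_sum.
- by move=> f b x; apply: zero_sum_coord_perm.
- exact: A_crystal_fix.
- apply/eqP=> /(congr1 (fun z : V => vsval z ord0 0))/eqP.
  by rewrite rootE eqxx vsval0 subr0 oner_eq0.
- move=> b b'; apply: zero_sum_ext => i; rewrite zero_sum_coordE vsvalZ.
  have -> : vsval (root R ord0 j1 *+ (b == b')) i 0 = vsval (root R ord0 j1) i 0 *+ (b == b').
    by rewrite raddfMn mulmxnE.
  by rewrite rootE mulrBr raddfB /= !lattice_coord_basisM // -mulrBr mulr_natl.
- move=> b; apply/A_crystalP.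
  exists 1%g, (lattice_basis alpha b *: root R ord0 j1); split=> //.
  by rewrite perm_map_transl perm_map_id.
- rewrite -[X in generated_by_reflections _ X]card_ord.
  apply: (generated_by_family (s := A_generator)) => //.
  + by move=> i; have := @A_reflection (lift ord0 i) 0 isT; rewrite scale0r.
  + exact: Lin_is_group.
  + by move=> i; apply/Lin_A_crystalP; eexists.
  + by move=> H HH Hs _ /Lin_A_crystalP[s ->]; apply: A_generation.
- rewrite -[X in (X + _)%N]card_ord -card_bool -card_sum.
  pose gen (x : 'I_n.+1 + bool) :=
    match x with inl i => A_generator i | inr b => A_affine_generator b end.
  apply: (generated_by_family (s := gen)) => //.
  + case=> [i|b]; last exact: A_reflection.
    by have := @A_reflection (lift ord0 i) 0 isT; rewrite scale0r.
  + case=> [i|b]; first exact: A_crystal_perm.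
    by apply/A_crystalP; do 2!eexists; split; last reflexivity.
  + move=> H HH Hs; apply: A_crystal_generation => // x.
      exact: (Hs (inl x)).
    exact: (Hs (inr x)).
Qed.

End PermutationGenerators.

Theorem proposition2p3 (R : realType) (alpha : R[i]) (halpha : modular_strip alpha) :
  (forall n : nat, (1 <= n)%N ->
     exists m : nat,
       min_reflections (Lin (G21_crystal (n := n) alpha)) m /\
       min_reflections (G21_crystal (n := n) alpha) (m + 2)%N) /\
  (forall n : nat, (2 <= n)%N ->
     exists m : nat,
       min_reflections (Lin (A_crystal (n := n) alpha)) m /\
       min_reflections (A_crystal (n := n) alpha) (m + 2)%N).
Proof.
have nz_alpha : complex.Im alpha != 0 by case: halpha => /lt0r_neq0.
split=> [[//|n] _|[|[|n]] // _]; first by exists n.+1; apply: min_reflections_G21.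
by exists n.+1; apply: min_reflections_A.
Qed.
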